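(* Let $\gamma\ge 2$ be an integer and let $G$ be a connected graph with maximum degree $\Delta\ge 3$. Put $M=\Delta\frac{(\Delta-1)^{\gamma}-1}{\Delta-2}$. If $G$ is non-regular, then $\chi_\gamma(G)\le M-1$.
   Context: Graphs are finite and simple. The $\gamma$-th power $G^\gamma$ of $G$ is the graph on the vertex set of $G$ in which two distinct vertices are adjacent if and only if their distance in $G$ is at most $\gamma$. $\chi_\gamma(G):=\chi(G^\gamma)$ is the chromatic number of $G^\gamma$. *)

(* Defs.v *)
From mathcomp Require Import all_boot.
Set Implicit Arguments.
Unset Strict Implicit.
Unset Printing Implicit Defensive.

Record sgraph := SGraph {
  vertex :> finType;
  adj : rel vertex;
  adj_sym : symmetric adj;
  adj_irrefl : irreflexive adj
}.

Definition degree (G : sgraph) (v : G) : nat := #|[set u | adj v u]|.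

Definition max_degree (G : sgraph) : nat := \max_(v : G) degree v.

Definition regular (G : sgraph) : Prop := exists d, forall v : G, degree v = d.

Definition connected (G : sgraph) : Prop := forall u v : G, connect (@adj G) u v.

Definition has_walk (G : sgraph) (u v : G) (n : nat) : bool :=
  [exists p : n.-tuple G, path (@adj G) u p && (last u p == v)].

(* The least length of a walk from u to v, or None if there is no walk. A
   shortest walk repeats no vertex, so only lengths below #|G| are searched. *)
Definition distance (G : sgraph) (u v : G) : option nat :=
  ohead [seq n <- iota 0 #|G| | has_walk u v n].

Definition power_adj (G : sgraph) (k : nat) : rel G := fun u v =>
  (u != v) && (if distance u v is Some d then d <= k else false).

Lemma has_walk_sym (G : sgraph) (u v : G) : has_walk u v =1 has_walk v u.
Proof.
move=> n; wlog suff: u v / has_walk u v n -> has_walk v u n.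
  by move=> imp; apply/idP/idP; apply: imp.
case/existsP=> p /andP[up /eqP <-]; apply/existsP.
have szp : size (rev (belast u p)) == n by rewrite size_rev size_belast size_tuple.
exists (Tuple szp) => /=; rewrite rev_path.
rewrite (eq_path (e' := @adj G)) ?up => [|x y]; last exact: adj_sym.
by case: {up szp} (tval p) => [|x q] //=; rewrite rev_cons last_rcons.
Qed.

Lemma power_adj_sym (G : sgraph) (k : nat) : symmetric (@power_adj G k).
Proof.
move=> u v; rewrite /power_adj /distance eq_sym.
by rewrite (eq_filter (has_walk_sym u v)).
Qed.

Lemma power_adj_irrefl (G : sgraph) (k : nat) : irreflexive (@power_adj G k).
Proof. by move=> u; rewrite /power_adj eqxx. Qed.

Definition power (G : sgraph) (k : nat) : sgraph :=
  SGraph (@power_adj_sym G k) (@power_adj_irrefl G k).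

Definition colorable (G : sgraph) (k : nat) : bool :=
  [exists f : {ffun G -> 'I_k}, [forall u, forall v, adj u v ==> (f u != f v)]].

Lemma colorable_card (G : sgraph) : exists k, colorable G k.
Proof.
exists #|G|; apply/existsP; exists [ffun v => enum_rank v].
apply/forallP=> u; apply/forallP=> v; apply/implyP=> uv.
rewrite !ffunE; apply: contraTneq uv => /enum_rank_inj->.
by rewrite adj_irrefl.
Qed.

Definition chromatic_number (G : sgraph) : nat := ex_minn (colorable_card G).

Definition chi_power (k : nat) (G : sgraph) : nat := chromatic_number (power G k).

(* Main.v *)
Require Import Defs.
From mathcomp Require Import all_boot all_order all_algebra.
From mathcomp Require Import zify.
Import GRing.Theory Num.Theory.
Local Open Scope ring_scope.

(** Write D for the maximum degree. A ball of radius gamma minus its centre has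
    at most M = D + D (D-1) + ... + D (D-1)^(gamma-1) vertices, the i-th term
    bounding the layer at distance i+1 from the centre ([card_shell_le]); a
    greedy colouring of the power graph therefore needs at most M + 1 colours.
    Two colours are saved by colouring in order of decreasing distance from a
    vertex v whose degree is less than D. When u gets its colour, at most
    M - 2 vertices of its ball are already coloured:
    - if u is neither v nor a neighbour of v, the next two vertices on a
      shortest path from u to v lie in the ball of u and are still uncoloured;
    - if u is a neighbour of v, then v is uncoloured, and since v has a
      missing edge the second layer around u is not full
      ([card_ball_adj_deficient]);
    - if u = v, the first two layers both miss a vertex
      ([card_ball_deficient]).
    Hence M - 1 colours are enough. The greedy argument is used in its
    degeneracy form, [degenerate_colorable], applied to a vertex of least
    distance to v in a given set. *)

Set Implicit Arguments.
Unset Strict Implicit.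
Unset Printing Implicit Defensive.

Local Open Scope nat_scope.

(** * Greedy colouring *)

(** Remove a vertex of small degree, colour the rest, put the vertex back: its
    neighbours leave a colour free. Colours are plain numbers during the
    induction, so that the case k = 0 (no vertices) needs no special care. *)
Lemma degenerate_colorable (H : sgraph) (k : nat) :
  (forall A : {set H}, A != set0 ->
     exists2 u, u \in A & #|[set w in A | adj u w]| < k) ->
  colorable H k.
Proof.
move=> deg.
have col (n : nat) (A : {set H}) : #|A| = n -> exists f : H -> nat,
    {in A, forall u, f u < k} /\ {in A &, forall u w, adj u w -> f u != f w}.
  elim: n A => [|n IHn] A cardA.
    by move/cards0_eq: cardA => ->; exists (fun _ => 0); split=> u; rewrite inE.
  have [|u uA ltk] := deg A; first by rewrite -card_gt0 cardA.
  have [|f [fk fP]] := IHn (A :\ u); first by move: cardA; rewrite (cardsD1 u) uA; lia.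
  set N := [set w in A | adj u w] in ltk.
  have [c ck cN] : exists2 c, c < k & c \notin [seq f w | w in N].
    case: (altP (@allP _ (mem [seq f w | w in N]) (iota 0 k))) => [sub|/allPn[c]].
      have := uniq_leq_size (iota_uniq 0 k) sub.
      by rewrite size_iota size_image leqNgt ltk.
    by rewrite mem_iota => ck cN; exists c.
  have neqc w : w \in A -> adj u w -> c != f w.
    move=> wA uw; apply: contra cN => /eqP->; apply: image_f.
    by rewrite inE wA.
  exists (fun w => if w == u then c else f w); split=> [w wA|w x wA xA wx].
    by case: eqP => [//|/eqP wu]; apply: fk; rewrite !inE wu.
  case: (eqVneq w u) wx => [->|wu] wx; case: (eqVneq x u) wx => [->|xu] wx.
  - by rewrite adj_irrefl in wx.
  - exact: neqc.
  - by rewrite eq_sym neqc // adj_sym.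
  - by apply: fP => //; rewrite !inE ?wu ?xu.
have [f [fk fP]] := col _ [set: H] erefl.
apply/existsP; exists [ffun u => Ordinal (fk u (in_setT u))].
apply/forallP=> u; apply/forallP=> w; apply/implyP=> uw.
by rewrite !ffunE -val_eqE /=; apply: fP; rewrite ?inE.
Qed.

Lemma chromatic_number_le (H : sgraph) (k : nat) :
  colorable H k -> chromatic_number H <= k.
Proof. by rewrite /chromatic_number; case: ex_minnP => m _; apply. Qed.

(** * Balls and their layers *)

Section Balls.

Variable G : sgraph.
Implicit Types u v w x y : G.

Fixpoint ball u (n : nat) : {set G} :=
  if n is n'.+1
  then ball u n' :|: [set w | [exists y in ball u n', adj y w]]
  else [set u].

Definition shell u n : {set G} := ball u n.+1 :\: ball u n.

Lemma ballS u n w :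
  reflect (w \in ball u n \/ exists2 y, y \in ball u n & adj y w)
          (w \in ball u n.+1).
Proof.
rewrite /= !inE; apply: (iffP orP) => -[wB|].
- by left.
- by case/existsP=> y /andP[]; right; exists y.
- by left.
- by case=> y yB yw; right; apply/existsP; exists y; rewrite yB.
Qed.

Arguments ball : simpl never.

Lemma ball_center u n : u \in ball u n.
Proof. by elim: n => [|n IHn]; [rewrite inE | apply/ballS; left]. Qed.

Lemma ball_mono u m n : m <= n -> ball u m \subset ball u n.
Proof.
move=> /subnK <-; elim: (n - m) => [//|d IHd].
by rewrite addSn; apply: subset_trans IHd _; apply: subsetUl.
Qed.

Lemma ball_adj u n w y : y \in ball u n -> adj y w -> w \in ball u n.+1.
Proof. by move=> yB yw; apply/ballS; right; exists y. Qed.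

Lemma path_ball u p : path (@adj G) u p -> last u p \in ball u (size p).
Proof.
elim/last_ind: p => [|p w IHp]; first by rewrite inE.
rewrite rcons_path last_rcons size_rcons => /andP[/IHp].
exact: ball_adj.
Qed.

Lemma power_adj_ball k u w : power_adj k u w -> w \in ball u k :\ u.
Proof.
rewrite /power_adj !inE eq_sym => /andP[-> /=].
case Ed: (distance u w) => [d|//] dk.
have : d \in [seq n <- iota 0 #|G| | has_walk u w n].
  by move: Ed; rewrite /distance; case: filter => //= a s [->]; rewrite inE eqxx.
rewrite mem_filter => /andP[/existsP[p /andP[up /eqP <-]] _].
apply: (subsetP (ball_mono u dk)).
by rewrite -[X in ball u X](size_tuple p); apply: path_ball.
Qed.

Lemma card_ball u n : #|ball u n| = (\sum_(i < n) #|shell u i|).+1.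
Proof.
elim: n => [|n IHn]; first by rewrite big_ord0 cards1.
rewrite big_ord_recr /= -addSn -IHn /shell cardsD (setIidPr (ball_mono u (leqnSn n))).
by rewrite subnKC // subset_leq_card // ball_mono.
Qed.

Lemma card_shell0 u : #|shell u 0| <= degree u.
Proof.
apply/subset_leq_card/subsetP=> w; rewrite in_setD => /andP[wu /ballS[wB|[y]]].
  by rewrite wB in wu.
by move=> /set1P-> uw; rewrite inE.
Qed.

(** One edge at each vertex of a layer leads back towards the centre. *)
Lemma card_shellS u n :
  #|shell u n.+1| <= \sum_(w in shell u n) (degree w).-1.
Proof.
pose F w := [set x | adj w x] :\: ball u n.+1.
have sub : shell u n.+1 \subset \bigcup_(w in shell u n) F w.
  apply/subsetP=> x; rewrite in_setD => /andP[xB /ballS[xB'|[y yB yx]]].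
    by rewrite xB' in xB.
  apply/bigcupP; exists y; last by rewrite in_setD xB inE.
  by rewrite in_setD yB andbT; apply: contra xB => /ball_adj; apply.
apply: leq_trans (subset_leq_card sub) _.
have cardU : #|\bigcup_(w in shell u n) F w| <= \sum_(w in shell u n) #|F w|.
  elim/big_rec2: _ => [|w m A _ leA]; first by rewrite cards0.
  by apply: leq_trans (leq_card_setU _ _) _; rewrite leq_add2l.
apply: leq_trans cardU _; apply: leq_sum => w.
rewrite in_setD => /andP[wB /ballS[wB'|[y yB yw]]]; first by rewrite wB' in wB.
have wy : y \in [set x | adj w x] by rewrite inE adj_sym.
rewrite /degree (cardsD1 y [set x | adj w x]) wy /=.
apply/subset_leq_card/subsetP=> x /setDP[xw xB].
rewrite in_setD1 xw andbT; apply: contraNneq xB => ->.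
by apply: (subsetP (ball_mono u (leqnSn n))).
Qed.

(** Breadth-first search from v: the rank of u is the distance from v to u. *)
Lemma connected_rank v : connected G ->
  exists r : G -> nat, forall u, u != v ->
    r v < r u /\ exists2 y, adj u y & r y < r u.
Proof.
move=> conn.
have inB u : exists n, u \in ball v n.
  have /connectP[p vp ->] := conn v u.
  by exists (size p); apply: path_ball.
exists (fun u => ex_minn (inB u)) => u uv.
have rle w n : w \in ball v n -> ex_minn (inB w) <= n.
  by move=> wB; case: ex_minnP => m _; apply.
case: (ex_minnP (inB u)) => -[|n]; first by rewrite inE (negPf uv).
move=> /ballS[uB /(_ n uB)|[y yB yu] _]; first by rewrite ltnn.
split; first by rewrite ltnS; apply: rle; apply: ball_center.
by exists y; [rewrite adj_sym | rewrite ltnS rle].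
Qed.

(** * Counting with bounded degree *)

Section MaxDegree.

Variable D : nat.
Hypothesis degD : forall w, degree w <= D.

Lemma sum_pred_degree_le (A : {set G}) :
  \sum_(w in A) (degree w).-1 <= #|A| * D.-1.
Proof.
rewrite -sum_nat_const; apply: leq_sum => w _.
by have := degD w; lia.
Qed.

Lemma card_shell_le u n : #|shell u n| <= D * D.-1 ^ n.
Proof.
elim: n => [|n IHn].
  by rewrite expn0 muln1; apply: leq_trans (card_shell0 u) (degD u).
apply: leq_trans (card_shellS u n) _; apply: leq_trans (sum_pred_degree_le _) _.
by rewrite expnSr mulnA leq_mul2r IHn orbT.
Qed.

(** Vertices missing from the first two layers are missing from any larger
    ball. *)
Lemma card_ball_missing u n e :
    #|shell u 0| + #|shell u 1| + e <= D + D * D.-1 ->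
  #|ball u n.+2 :\ u| + e <= \sum_(i < n.+2) D * D.-1 ^ i.
Proof.
move=> le2; have := card_ball u n.+2.
rewrite (cardsD1 u) ball_center add1n => /succn_inj->.
rewrite !big_ord_recl /= expn0 muln1.
have leS : \sum_(i < n) #|shell u (bump 0 (bump 0 i))|
    <= \sum_(i < n) D * D.-1 ^ bump 0 (bump 0 i).
  by apply: leq_sum => i _; apply: card_shell_le.
by move: leS le2; rewrite /bump /= addn0 expn1; lia.
Qed.

Lemma card_ball_le u n : #|ball u n.+2 :\ u| <= \sum_(i < n.+2) D * D.-1 ^ i.
Proof.
rewrite -[X in X <= _]addn0; apply: card_ball_missing.
rewrite addn0; have := leq_add (card_shell_le u 0) (card_shell_le u 1).
by rewrite expn0 expn1 muln1.
Qed.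

Lemma card_ball_deficient v n : 1 < D -> degree v < D ->
  #|ball v n.+2 :\ v| + 2 <= \sum_(i < n.+2) D * D.-1 ^ i.
Proof.
move=> D1 dv; apply: card_ball_missing.
have s0 := card_shell0 v.
have s1 := leq_trans (card_shellS v 0) (sum_pred_degree_le _).
by nia.
Qed.

(** The neighbour v of u has at most D - 2 edges to the second layer. *)
Lemma card_ball_adj_deficient u v n : 1 < D -> adj u v -> degree v < D ->
  #|ball u n.+2 :\ u| + 1 <= \sum_(i < n.+2) D * D.-1 ^ i.
Proof.
move=> D1 uv dv; apply: card_ball_missing.
have vS : v \in shell u 0.
  rewrite in_setD (ball_adj (ball_center u 0) uv) andbT inE.
  by apply: contraTneq uv => ->; rewrite adj_irrefl.
have s0 := leq_trans (card_shell0 u) (degD u).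
have := card_shellS u 0; rewrite (big_setD1 v vS) /=.
have := sum_pred_degree_le (shell u 0 :\ v).
by move: s0; rewrite (cardsD1 v) vS; nia.
Qed.

(** * Colouring the power graph *)

(** Two vertices of the full count are always saved: each is either of smaller
    rank than u, hence not in A, or missing from the ball around u because of the
    low degree of v. *)
Lemma card_later_power_nbrs v (r : G -> nat) n u (A : {set G}) :
    1 < D -> degree v < D ->
    (forall w, w != v -> r v < r w /\ exists2 y, adj w y & r y < r w) ->
    {in A, forall w, r u <= r w} ->
  #|[set w in A | power_adj n.+2 u w]| + 2 <= \sum_(i < n.+2) D * D.-1 ^ i.
Proof.
move=> D1 dv rP Amin; set C := [set w in A | _].
(* Vertices of smaller rank in the ball are counted in the ball, not in C. *)
have cardC (T : {set G}) : T \subset ball u n.+2 ->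
    {in T, forall w, r w < r u} -> #|C| + #|T| <= #|ball u n.+2 :\ u|.
  move=> TB Tr; rewrite -cardsUI.
  have -> : C :&: T = set0.
    apply/setP=> w; rewrite !inE; apply/negP=> /andP[/andP[wA _] /Tr].
    by rewrite ltnNge Amin.
  rewrite cards0 addn0; apply/subset_leq_card; rewrite subUset; apply/andP; split.
    by apply/subsetP=> w; rewrite inE => /andP[_ /power_adj_ball].
  by rewrite subsetD1 TB /=; apply/negP=> /Tr; rewrite ltnn.
have ball1 y : adj u y -> y \in ball u 1 by apply/ball_adj/ball_center.
have [uv|uv] := eqVneq u v.
  have := cardC set0; rewrite sub0set cards0 => /(_ isT) leC.
  apply: leq_trans (card_ball_deficient n D1 dv); rewrite -uv leq_add2r.
  by rewrite -[#|C|]addn0; apply: leC => w; rewrite inE.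
have [ruv [y uy ry]] := rP u uv.
have [auv|nauv] := boolP (adj u v).
  have := card_ball_adj_deficient n D1 auv dv.
  have := cardC [set v]; rewrite cards1 sub1set.
  rewrite (subsetP (ball_mono u (isT : 1 <= n.+2)) _ (ball1 v auv)) => /(_ isT) leC.
  have {leC} : #|C| + 1 <= #|ball u n.+2 :\ u|.
    by apply: leC => w; rewrite inE => /eqP->.
  by lia.
have yv : y != v by apply: contraNneq nauv => <-.
have [_ [z yz rz]] := rP y yv.
apply: leq_trans (card_ball_le u n).
have <- : #|[set y; z]| = 2.
  by rewrite cards2 (contraTneq _ yz) // => ->; rewrite adj_irrefl.
apply: cardC => [|w].
  rewrite subUset !sub1set.
  rewrite (subsetP (ball_mono u (isT : 1 <= n.+2)) _ (ball1 y uy)) /=.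
  by apply: (subsetP (ball_mono u (isT : 2 <= n.+2))); apply: ball_adj (ball1 y uy) yz.
by rewrite !inE => /orP[] /eqP-> //; apply: ltn_trans ry.
Qed.

Lemma chi_power_deficient v n : connected G -> 1 < D -> degree v < D ->
  chi_power n.+2 G + 1 <= \sum_(i < n.+2) D * D.-1 ^ i.
Proof.
move=> conn D1 dv; have [r rP] := connected_rank v conn.
set M := \sum_(i < _) _.
have M_gt1 : 1 < M by have := card_ball_deficient n D1 dv; rewrite -/M; lia.
suff col : colorable (power G n.+2) M.-1.
  by have := chromatic_number_le col; rewrite /chi_power; lia.
apply: degenerate_colorable => A /set0Pn[u0 u0A].
case: (arg_minnP r u0A) => u uA umin; exists u => //.
by have := card_later_power_nbrs n D1 dv rP umin; rewrite -/M /=; lia.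
Qed.

End MaxDegree.
End Balls.

Unset Implicit Arguments.
Set Strict Implicit.
Set Printing Implicit Defensive.

Local Open Scope ring_scope.

Theorem corollary2p5 (gamma : nat) (G : sgraph) (Delta : nat) (M : rat)
  (hgamma : (2 <= gamma)%N)
  (hconn : connected G)
  (hmax : max_degree G = Delta)
  (hDelta : (3 <= Delta)%N)
  (hM : M = Delta%:R * (((Delta%:R - 1) ^+ gamma - 1) / (Delta%:R - 2)))
  (hreg : ~ regular G) :
  (chi_power gamma G)%:R <= M - 1.
Proof.
have degD (w : G) : (degree w <= Delta)%N by rewrite -hmax; apply: leq_bigmax.
have [v dv] : exists v : G, (degree v < Delta)%N.
  have [/existsP //|] := boolP [exists v : G, (degree v < Delta)%N].
  rewrite negb_exists => /forallP all_ge; case: hreg; exists Delta => v.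
  by apply/eqP; rewrite eqn_leq degD leqNgt all_ge.
case: gamma hgamma hM => [|[|n]] // _ hM.
have D2 : (1 < Delta)%N by apply: ltn_trans hDelta.
(* The closed form of M is the sum of a geometric progression. *)
have -> : M = (\sum_(i < n.+2) Delta * Delta.-1 ^ i)%N%:R.
  have D1E : Delta%:R - 1 = Delta.-1%:R :> rat.
    by rewrite -subn1 natrB // ltnW.
  have D2E : Delta%:R - 2 = Delta.-1%:R - 1 :> rat.
    by rewrite -D1E -addrA -opprD.
  have nz : Delta.-1%:R - 1 != 0 :> rat.
    by rewrite subr_eq0 (eqr_nat _ _ 1); lia.
  rewrite hM D1E D2E subrX1 mulrAC divff // mul1r natr_sum big_distrr /=.
  by apply: eq_bigr => i _; rewrite natrM natrX.
rewrite lerBrDr -(natrD _ _ 1) ler_nat.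
exact: chi_power_deficient hconn D2 dv.
Qed.
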